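(* Let $\mathcal{H}$ be a Hilbert space, let $\{f_j\}_{j=1}^L$ and $\{g_j\}_{j=1}^L$ be finite sequences in $\mathcal{H}$ with $\{f_j\}_{j=1}^L$ linearly independent, and let $R=I-\sum_{j=1}^L f_j\otimes g_j$. If $R$ is invertible, then a formula for the inverse is $$R^{-1}=I+\sum_{j,k=1}^L c_{jk}\,f_j\otimes g_k,$$ where the coefficient matrix $C:=(c_{jk})_{j,k=1}^L$ is given by $C=(I-M)^{-1}$, with $I$ here the $L\times L$ identity matrix and $M$ the $L\times L$ matrix whose entry in row $j$ and column $k$ is $\langle f_k,g_j\rangle$, i.e. $$M=\begin{pmatrix}\langle f_1,g_1\rangle&\langle f_2,g_1\rangle&\cdots&\langle f_L,g_1\rangle\\ \langle f_1,g_2\rangle&\langle f_2,g_2\rangle&\cdots&\langle f_L,g_2\rangle\\ \vdots&\vdots&\ddots&\vdots\\ \langle f_1,g_L\rangle&\langle f_2,g_L\rangle&\cdots&\langle f_L,g_L\rangle\end{pmatrix}.$$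
   Context: Inner products are linear in the first variable. For $x,y\in\mathcal{H}$, $x\otimes y$ denotes the rank one operator $(x\otimes y)(z)=\langle z,y\rangle x$. *)

(* Defs.v *)
From HB Require Import structures.
From mathcomp Require Import all_boot all_order all_algebra.
From mathcomp Require Import sesquilinear complex.
From mathcomp Require Import all_classical all_reals all_analysis.

Set Implicit Arguments.
Unset Strict Implicit.
Unset Printing Implicit Defensive.

Import Order.TTheory GRing.Theory Num.Theory.
Import numFieldNormedType.Exports.

Local Open Scope ring_scope.
Local Open Scope complex_scope.

(* Hilbert spaces may be real or complex; the flag selects the scalar field. *)
Inductive scalar_kind := Real_scalars | Complex_scalars.

Definition scalar_field (R : realType) (s : scalar_kind) : numFieldType :=
  match s with
  | Real_scalars => R : numFieldType
  | Complex_scalars => R[i] : numFieldType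
  end.

Definition scalar_conj (R : realType) (s : scalar_kind) :
    scalar_field R s -> scalar_field R s :=
  match s with
  | Real_scalars => fun a : R => a
  | Complex_scalars => fun a : R[i] => Num.conj a
  end.

(* In the library, [{dot H for theta}] is the type of positive definite
   Hermitian forms that are linear in the first variable and theta-linear in
   the second one. *)
Record hilbertSpace (R : realType) (s : scalar_kind) := HilbertSpace {
  hilbert_carrier :> completeNormedModType (scalar_field R s);
  inner : {dot hilbert_carrier for @scalar_conj R s};
  normrX2_inner : forall x : hilbert_carrier, `|x| ^+ 2 = inner x x
}.

Arguments inner {R s h}.

Section HilbertOperators.
Context {R : realType} {s : scalar_kind} {H : hilbertSpace R s}.

Definition rank_one (x y : H) : H -> H := fun z => inner z y *: x.

(* The library's [free] is only available in finite dimension. *)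
Definition linearly_independent (L : nat) (f : 'I_L -> H) : Prop :=
  forall a : 'I_L -> scalar_field R s,
    \sum_(j < L) a j *: f j = 0 -> forall j, a j = 0.

Definition bounded_operator (T : H -> H) : Prop := linear T /\ continuous T.

Definition is_inverse (T S : H -> H) : Prop :=
  [/\ bounded_operator S, cancel T S & cancel S T].

Definition invertible (T : H -> H) : Prop := exists S : H -> H, is_inverse T S.

End HilbertOperators.

(* Main.v *)
Require Import Defs.
From HB Require Import structures.
From mathcomp Require Import all_boot all_order all_algebra.
From mathcomp Require Import sesquilinear complex.
From mathcomp Require Import all_classical all_reals all_analysis.

Import Order.TTheory GRing.Theory Num.Theory.
Import numFieldNormedType.Exports.

Local Open Scope ring_scope.

(** The operator [I - \sum_j f_j \otimes g_j] factors through coordinates: if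
    [F] is the synthesis map sending a column [a] to [\sum_j a_j f_j], and [G]
    the analysis map sending [z] to the column of the [<z, g_j>], then
    [T = I - F G], while [G F] is the matrix [M].  The formula for the inverse is
    therefore the Sherman-Morrison-Woodbury identity
    [(I - F G)^-1 = I + F (I - G F)^-1 G].

    The matrix [I - M] is invertible because [T F = F (I - M)], where [F] is
    injective (the [f_j] are linearly independent) and so is [T]
    ([unitmx_one_sub_gram]).  The identity shows that [I + F C G] is a right
    inverse of [T] ([one_sub_FG_woodbury]).  It thus coincides with the given
    bounded inverse of [T], from which it inherits linearity and continuity, so
    that no norm estimate on the rank one operators is required. *)

Section SynthesisAnalysis.
Context {R : realType} {s : scalar_kind} {H : hilbertSpace R s} {L : nat}.
Local Notation K := (scalar_field R s).
Implicit Types (f g : 'I_L -> H) (a : 'cV[K]_L) (z : H).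

Definition synthesis f a : H := \sum_(j < L) a j ord0 *: f j.

Definition analysis g z : 'cV[K]_L := \col_j inner z (g j).

Definition gram f g : 'M[K]_L := \matrix_(j < L, k < L) inner (f k) (g j).

Lemma synthesis_linear f : linear (synthesis f).
Proof.
move=> c a b; rewrite /synthesis scaler_sumr -big_split /=.
by apply: eq_bigr => j _; rewrite !mxE scalerDl scalerA.
Qed.
HB.instance Definition _ f :=
  GRing.isLinear.Build K 'cV[K]_L H *:%R (synthesis f) (synthesis_linear f).

Lemma analysis_linear g : linear (analysis g).
Proof.
by move=> c x y; apply/colP => j; rewrite !mxE linearDl linearZl_LR.
Qed.
HB.instance Definition _ g :=
  GRing.isLinear.Build K H 'cV[K]_L *:%R (analysis g) (analysis_linear g).

Lemma analysis_synthesis f g a : analysis g (synthesis f a) = gram f g *m a.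
Proof.
rewrite /synthesis linear_sum; apply/colP => j; rewrite summxE mxE.
by apply: eq_bigr => k _; rewrite linearZ !mxE mulrC.
Qed.

Lemma synthesis_inj f : linearly_independent f -> injective (synthesis f).
Proof.
move=> f_indep a b /eqP; rewrite -subr_eq0 -linearB => /eqP /f_indep ab0.
by apply/subr0_eq/colP => j; rewrite ab0 mxE.
Qed.

Lemma sum_rank_oneE f g z :
  (\sum_(j < L) rank_one (f j) (g j)) z = synthesis f (analysis g z).
Proof.
by rewrite fct_sumE; apply: eq_bigr => j _; rewrite mxE.
Qed.

Lemma sum_coef_rank_oneE f g (C : 'M[K]_L) z :
  (\sum_(j < L) \sum_(k < L) C j k *: rank_one (f j) (g k)) z
  = synthesis f (C *m analysis g z).
Proof.
rewrite fct_sumE; apply: eq_bigr => j _; rewrite fct_sumE mxE scaler_suml.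
by apply: eq_bigr => k _; rewrite mxE -scalerA.
Qed.

(** The intertwining relation [(I - F G) F = F (I - G F)] transfers the
    injectivity of [I - F G] and [F] to the square matrix [I - G F]. *)
Lemma unitmx_one_sub_gram f g :
    linearly_independent f ->
    injective (fun z => z - synthesis f (analysis g z)) ->
  1%:M - gram f g \in unitmx.
Proof.
move=> f_indep T_inj; rewrite -unitmx_tr -row_free_unit.
apply: inj_row_free => v vM0; apply: trmx_inj; rewrite trmx0.
apply: (synthesis_inj f f_indep); rewrite linear0; apply: T_inj.
rewrite analysis_synthesis -linearB !linear0 addr0.
rewrite -{1}[v^T]mul1mx -mulmxBl -[1%:M - _]trmxK -trmx_mul vM0.
by rewrite trmx0 linear0.
Qed.

(** With [C = (I - G F)^-1], the error term of
    [(I - F G) (I + F C G) = I + F (C - I - G F C) G] vanishes because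
    [(I - G F) C = I]. *)
Lemma one_sub_FG_woodbury f g (C : 'M[K]_L) :
    (1%:M - gram f g) *m C = 1%:M ->
  cancel (fun z => z + synthesis f (C *m analysis g z))
         (fun z => z - synthesis f (analysis g z)).
Proof.
move=> MC1 z /=; rewrite [analysis g (_ + _)]linearD /= analysis_synthesis.
rewrite -addrA -linearB /= mulmxA opprD addrCA addrC -mulmxBl.
have -> : C - gram f g *m C = 1%:M by rewrite -MC1 mulmxBl mul1mx.
by rewrite mul1mx addNr linear0 add0r.
Qed.

End SynthesisAnalysis.

Theorem theorem6p2 (R : realType) (s : scalar_kind) (H : hilbertSpace R s)
    (L : nat) (f g : 'I_L -> H) (f_indep : linearly_independent f) :
  let T : H -> H := idfun - \sum_(j < L) rank_one (f j) (g j) in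
  let M : 'M[scalar_field R s]_L := \matrix_(j < L, k < L) inner (f k) (g j) in
  let C : 'M[scalar_field R s]_L := invmx (1%:M - M) in
  invertible T ->
  1%:M - M \in unitmx /\
  is_inverse T
    (idfun + \sum_(j < L) \sum_(k < L) C j k *: rank_one (f j) (g k)).
Proof.
move=> T M C [S' [S'_bounded TK S'K]].
have TE : T = fun z => z - synthesis f (analysis g z).
  by apply/funext => z; rewrite /T -sum_rank_oneE.
have M_unit : 1%:M - M \in unitmx.
  by apply: (unitmx_one_sub_gram f g f_indep); rewrite -TE; exact: can_inj TK.
split=> //; set S := (X in is_inverse T X).
have SE : S = fun z => z + synthesis f (C *m analysis g z).
  by apply/funext => z; rewrite /S -sum_coef_rank_oneE.
have SK : cancel S T.
  by rewrite TE SE; apply: one_sub_FG_woodbury; exact: mulmxV.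
(* A right inverse of [T] is its unique two-sided inverse. *)
suff -> : S = S' by [].
by apply/funext => z; rewrite -[LHS]TK SK.
Qed.
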